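(* Let $c\in\mathbb{N}$ and $\varepsilon\in(0,1]$. Consider a memoryless stochastic temporal graph on $G=(V,E)$ with $n$ vertices and $m$ edges, with probabilities $p_e\geq\frac{1}{n^c}$ for every $e\in E$, and distinct vertices $s,y\in V$. Suppose there exists an algorithm $A$ that, given a natural number $\ell$, computes the probabilities $\Pr[X(s,y)\geq i]$ for all $i=1,\ldots,\ell$ in time $O(f(\ell,n,m))$. Then there exists an algorithm $B$ that approximates $\mathbb{E}[X(s,y)]$ within the additive factor $\varepsilon$ (i.e., outputs a number differing from $\mathbb{E}[X(s,y)]$ by less than $\varepsilon$) in time $$O\Big(f\big(n^{c+1}\ln\tfrac{n}{\varepsilon},n,m\big)+n\ln n+m\Big).$$ Consequently, if $f(\ell,n,m)$ is a polynomial in $\ell,n,m$, then $B$ is a fully polynomial-time approximation scheme (running time polynomial in $n$ and $1/\varepsilon$, additive error $\varepsilon$) on the instance.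
   Context: A memoryless stochastic temporal graph on $G=(V,E)$ with probabilities $\{p_e\}$ is the random sequence of snapshots $G_t=(V,E_t)$, $t=1,2,\ldots$, where each edge $e$ belongs to $E_t$ with probability $p_e$, independently over all edges and time steps. An $s$-$y$ journey is a sequence $((e_1,t_1),\ldots,(e_x,t_x))$ with $e_i\in E_{t_i}$, $(e_1,\ldots,e_x)$ a path from $s$ to $y$ in $G$, and $t_1<\cdots<t_x$; its arrival time is $t_x$. $X(s,y)$ denotes the minimum arrival time of an $s$-$y$ journey. *)

(* Defs.v *)
From HB Require Import structures.
From mathcomp Require Import all_boot all_order all_algebra finmap.
From mathcomp Require Import all_classical all_reals all_analysis.

Set Implicit Arguments.
Unset Strict Implicit.
Unset Printing Implicit Defensive.
Import Order.TTheory GRing.Theory Num.Theory.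
Import numFieldNormedType.Exports.

Local Open Scope classical_set_scope.
Local Open Scope ring_scope.

(* Mutual independence: the product rule over every finite subfamily. *)
Definition mutually_independent (R : realType) (d : measure_display)
    (T : measurableType d) (P : probability T R) (I : choiceType)
    (D : set I) (A : I -> set T) : Prop :=
  forall F : {fset I}, [set` F] `<=` D ->
    P (\bigcap_(i in [set` F]) A i) = (\prod_(i <- F) P (A i))%E.

(* A finite simple undirected graph with vertex set 'I_nv and edge set 'I_ne
   (src e and dst e are the two ends of e, in no significant order), together
   with the random snapshots on some probability space.  Time starts at 1:
   snap 0 plays no role. *)
Record stgraph (R : realType) : Type := STGraph {
  nv : nat;
  ne : nat;
  src : 'I_ne -> 'I_nv;
  dst : 'I_ne -> 'I_nv;
  no_loop : forall e, src e != dst e;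
  no_parallel : forall e e',
    (src e, dst e) = (src e', dst e') \/ (src e, dst e) = (dst e', src e') ->
    e = e';
  prob : 'I_ne -> R;
  disp : measure_display;
  outcome : measurableType disp;
  law : probability outcome R;
  snap : nat -> outcome -> {set 'I_ne};
  snap_measurable : forall e t, (0 < t)%N ->
    measurable [set w | e \in snap t w];
  snap_prob : forall e t, (0 < t)%N ->
    law [set w | e \in snap t w] = (prob e)%:E;
  snap_indep : mutually_independent law
    [set et : 'I_ne * nat | (0 < et.2)%N]
    (fun et => [set w | et.1 \in snap et.2 w])
}.

Section Journeys.
Variables (R : realType) (G : stgraph R).

Definition joins (e : 'I_(ne G)) (u v : 'I_(nv G)) : bool :=
  ((src e == u) && (dst e == v)) || ((src e == v) && (dst e == u)).

Fixpoint walk (u : 'I_(nv G)) (es : seq 'I_(ne G)) (vs : seq 'I_(nv G)) :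
    bool :=
  match es, vs with
  | [::], [::] => true
  | e :: es', v :: vs' => joins e u v && walk v es' vs'
  | _, _ => false
  end.

Definition is_path (s y : 'I_(nv G)) (es : seq 'I_(ne G)) : Prop :=
  exists vs, [/\ walk s es vs, uniq (s :: vs) & last s vs = y].

Definition is_journey (w : outcome G) (s y : 'I_(nv G))
    (J : seq ('I_(ne G) * nat)) : Prop :=
  [/\ is_path s y (unzip1 J), sorted ltn (unzip2 J) &
      forall et, et \in J -> (0 < et.2)%N /\ et.1 \in snap et.2 w].

Definition arrival (J : seq ('I_(ne G) * nat)) : nat := last 0%N (unzip2 J).

(* +oo when there is no journey *)
Definition X (s y : 'I_(nv G)) (w : outcome G) : \bar R :=
  ereal_inf [set (arrival J)%:R%:E | J in is_journey w s y].

Definition PrX_ge (s y : 'I_(nv G)) (i : nat) : \bar R :=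
  law G [set w | (i%:R%:E <= X s y w)%E].

(* The expectation 'E_P[_] of the library is for real-valued variables; this is
   its defining integral, for the extended-real X. *)
Definition EX (s y : 'I_(nv G)) : \bar R :=
  (\int[law G]_w X s y w)%E.

End Journeys.

(* Imperative programs over natural-number and real registers and growable
   arrays.  Every operation has unit cost; besides field operations and
   comparisons, the reals have the logarithm as a primitive.  There is no
   real-valued literal, no floor function, and no way to extend an array by more
   than one cell per step.  Reading outside of an array gives 0, and writing
   there has no effect. *)

Inductive nexp : Type :=
| NVar of nat
| NLit of nat
| NAdd of nexp & nexp
| NSub of nexp & nexp
| NMul of nexp & nexp
| NSize of nat
| NSizeR of nat
| NGet of nat & nexp.

Inductive rexp : Type :=
| RVar of nat
| ROfN of nexp
| RAdd of rexp & rexp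
| RSub of rexp & rexp
| RMul of rexp & rexp
| RDiv of rexp & rexp
| RLn of rexp
| RGet of nat & nexp.

Inductive bexp : Type :=
| BNLt of nexp & nexp
| BRLt of rexp & rexp
| BNot of bexp
| BAnd of bexp & bexp.

Inductive cmd : Type :=
| Skip
| SetN of nat & nexp
| SetR of nat & rexp
| PushN of nat & nexp
| PushR of nat & rexp
| PutN of nat & nexp & nexp          (* array, index, value *)
| PutR of nat & nexp & rexp
| Seq of cmd & cmd
| If of bexp & cmd & cmd
| While of bexp & cmd.

Record store (R : realType) : Type := Store {
  nreg : nat -> nat;
  rreg : nat -> R;
  narr : nat -> seq nat;
  rarr : nat -> seq R
}.

Definition upd (T : Type) (g : nat -> T) (k : nat) (v : T) : nat -> T :=
  fun j => if j == k then v else g j.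

Definition put (T : Type) (a : seq T) (i : nat) (v : T) : seq T :=
  if (i < size a)%N then set_nth v a i v else a.

Section Semantics.
Variable R : realType.
Implicit Type σ : store R.

Definition set_nreg σ k v := Store (upd (nreg σ) k v) (rreg σ) (narr σ) (rarr σ).
Definition set_rreg σ k v := Store (nreg σ) (upd (rreg σ) k v) (narr σ) (rarr σ).
Definition set_narr σ k v := Store (nreg σ) (rreg σ) (upd (narr σ) k v) (rarr σ).
Definition set_rarr σ k v := Store (nreg σ) (rreg σ) (narr σ) (upd (rarr σ) k v).

Fixpoint neval σ (a : nexp) : nat :=
  match a with
  | NVar k => nreg σ k
  | NLit k => k
  | NAdd a b => neval σ a + neval σ b
  | NSub a b => neval σ a - neval σ b
  | NMul a b => neval σ a * neval σ b
  | NSize k => size (narr σ k)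
  | NSizeR k => size (rarr σ k)
  | NGet k i => nth 0 (narr σ k) (neval σ i)
  end%N.

Fixpoint reval σ (a : rexp) : R :=
  match a with
  | RVar k => rreg σ k
  | ROfN n => (neval σ n)%:R
  | RAdd a b => reval σ a + reval σ b
  | RSub a b => reval σ a - reval σ b
  | RMul a b => reval σ a * reval σ b
  | RDiv a b => reval σ a / reval σ b
  | RLn a => ln (reval σ a)
  | RGet k i => nth 0 (rarr σ k) (neval σ i)
  end.

Fixpoint beval σ (b : bexp) : bool :=
  match b with
  | BNLt a b => (neval σ a < neval σ b)%N
  | BRLt a b => reval σ a < reval σ b
  | BNot b => ~~ beval σ b
  | BAnd b c => beval σ b && beval σ c
  end.

Fixpoint ncost (a : nexp) : nat :=
  match a with
  | NVar _ | NLit _ | NSize _ | NSizeR _ => 1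
  | NAdd a b | NSub a b | NMul a b => (ncost a + ncost b).+1
  | NGet _ i => (ncost i).+1
  end%N.

Fixpoint rcost (a : rexp) : nat :=
  match a with
  | RVar _ => 1
  | ROfN n => (ncost n).+1
  | RAdd a b | RSub a b | RMul a b | RDiv a b => (rcost a + rcost b).+1
  | RLn a => (rcost a).+1
  | RGet _ i => (ncost i).+1
  end%N.

Fixpoint bcost (b : bexp) : nat :=
  match b with
  | BNLt a b => (ncost a + ncost b).+1
  | BRLt a b => (rcost a + rcost b).+1
  | BNot b => (bcost b).+1
  | BAnd b c => (bcost b + bcost c).+1
  end%N.

(* exec p σ t σ': started in σ, p halts in σ' after t steps. *)
Inductive exec : cmd -> store R -> nat -> store R -> Prop :=
| ESkip σ : exec Skip σ 1 σ
| ESetN σ k a : exec (SetN k a) σ (ncost a).+1 (set_nreg σ k (neval σ a))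
| ESetR σ k a : exec (SetR k a) σ (rcost a).+1 (set_rreg σ k (reval σ a))
| EPushN σ k a :
    exec (PushN k a) σ (ncost a).+1
      (set_narr σ k (rcons (narr σ k) (neval σ a)))
| EPushR σ k a :
    exec (PushR k a) σ (rcost a).+1
      (set_rarr σ k (rcons (rarr σ k) (reval σ a)))
| EPutN σ k i a :
    exec (PutN k i a) σ (ncost i + ncost a).+1
      (set_narr σ k (put (narr σ k) (neval σ i) (neval σ a)))
| EPutR σ k i a :
    exec (PutR k i a) σ (ncost i + rcost a).+1
      (set_rarr σ k (put (rarr σ k) (neval σ i) (reval σ a)))
| ESeq p q σ1 t1 σ2 t2 σ3 :
    exec p σ1 t1 σ2 -> exec q σ2 t2 σ3 -> exec (Seq p q) σ1 (t1 + t2) σ3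
| EIfT b p q σ t σ' :
    beval σ b -> exec p σ t σ' -> exec (If b p q) σ (bcost b + t).+1 σ'
| EIfF b p q σ t σ' :
    ~~ beval σ b -> exec q σ t σ' -> exec (If b p q) σ (bcost b + t).+1 σ'
| EWhileF b p σ : ~~ beval σ b -> exec (While b p) σ (bcost b).+1 σ
| EWhileT b p σ1 t1 σ2 t2 σ3 :
    beval σ1 b -> exec p σ1 t1 σ2 -> exec (While b p) σ2 t2 σ3 ->
    exec (While b p) σ1 (bcost b + t1 + t2).+1 σ3.

End Semantics.

Section Algorithms.
Variable R : realType.

(* Initial store: the graph is given by its edge list, with probabilities; l and
   eps are the further numerical inputs, and all other cells are 0 or empty. *)
Definition input (G : stgraph R) (s y : 'I_(nv G)) (l : nat) (eps : R) :
    store R :=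
  Store (nth 0%N [:: nv G; ne G; val s; val y; l])
        (nth 0 [:: eps])
        (nth [::] [:: [seq val (src e) | e <- enum 'I_(ne G)];
                      [seq val (dst e) | e <- enum 'I_(ne G)]])
        (nth [::] [:: [seq prob e | e <- enum 'I_(ne G)]]).

Definition tail_output (σ : store R) : seq R := rarr σ 1.
Definition real_output (σ : store R) : R := rreg σ 1.

Definition instances : Type := forall G : stgraph R, 'I_(nv G) -> 'I_(nv G) -> Prop.

(* A computes Pr[X(s,y) >= i] for i = 1, ..., l in time O(f(l,n,m)). *)
Definition computes_tails (K : instances) (A : cmd)
    (f : nat -> nat -> nat -> R) : Prop :=
  exists2 C : R, 0 < C &
    forall (G : stgraph R) (s y : 'I_(nv G)), K G s y ->
    forall l : nat, (0 < l)%N ->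
    exists t σ, [/\ exec A (input s y l 0) t σ,
      [seq r%:E | r <- tail_output σ] = [seq PrX_ge s y i | i <- iota 1 l] &
      t%:R <= C * f l (nv G) (ne G)].

(* The strict bound forces the expectation to be finite. *)
Definition approximates_EX (K : instances) (B : cmd)
    (T : nat -> nat -> R -> R) : Prop :=
  forall (G : stgraph R) (s y : 'I_(nv G)), K G s y ->
  forall eps : R, 0 < eps <= 1 ->
  exists t σ, [/\ exec B (input s y 0 eps) t σ,
    (`|(real_output σ)%:E - EX s y| < eps%:E)%E &
    t%:R <= T (nv G) (ne G) eps].

Definition approximates_EX_in_O (K : instances) (B : cmd)
    (T : nat -> nat -> R -> R) : Prop :=
  exists2 C : R, 0 < C & approximates_EX K B (fun n m eps => C * T n m eps).

Definition is_polynomial3 (f : nat -> nat -> nat -> R) : Prop :=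
  exists q : {poly {poly {poly R}}}, forall l n m : nat,
    f l n m = q.[l%:R%:P%:P].[n%:R%:P].[m%:R].

(* Additive error eps, running time polynomial in n and 1/eps. *)
Definition fptas (K : instances) (B : cmd) : Prop :=
  exists q : {poly {poly R}},
    approximates_EX K B (fun n _ eps => q.[n%:R%:P].[eps^-1]).

(* Rounded up, since f takes natural numbers. *)
Definition horizon (c n : nat) (eps : R) : nat :=
  `|Num.ceil (n%:R ^+ c.+1 * ln (n%:R / eps))|%N.

End Algorithms.

(* Main.v *)
(* E[X] is the sum of the tails Pr[X >= i], so B sums the first l of them; it obtains l by counting
   up to the horizon, which A's running time pays for since A has to write l numbers.

   The omitted tails are compared with the greedy traversal of one fixed s-y path with k < n edges:
   giving weight x ^+ (number of edges left), x > 1, to its state, each step contracts the expected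
   weight by rho = 1 - p (1 - 1/x), p = n^-c, so that Pr[X > j] <= x^(k-1) rho^j and the omitted
   tails add up to at most x^(k-1) rho^l / (1 - rho).  With z = n / eps and x = sqrt z this is less
   than eps at the horizon as soon as z >= 4^(c+2).

   Below that threshold the horizon can be too short (for n = 2, c = 3, eps = 1, p = 1/8 the
   truncated sum is off by more than 1).  But then n is bounded and eps is bounded below, so a
   constant number of tails is enough and costs O(1), whatever f is. *)
Require Import Defs.
From mathcomp Require Import all_boot all_order all_algebra finmap.
From mathcomp Require Import all_classical all_reals all_analysis.
From mathcomp Require Import measurable_realfun zify ring lra.
Set Implicit Arguments.
Unset Strict Implicit.
Unset Printing Implicit Defensive.
Import Order.TTheory GRing.Theory Num.Theory.
Local Open Scope ring_scope.

(** * The program B *)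

Lemma size_put (T : Type) (a : seq T) i v : size (put a i v) = size a.
Proof.
by rewrite /put; case: ifP => // lt_ia; rewrite size_set_nth; apply/maxn_idPr.
Qed.

Lemma exec_gt0 (R : realType) p (s : store R) t s' : exec p s t s' -> (0 < t)%N.
Proof. by elim=> //= *; lia. Qed.

(** An array gains at most one cell per step. Hence the running time of A is at least the number of
    tails that it writes, which pays for the counting and summing done by B. *)
Lemma exec_size_rarr (R : realType) p (s : store R) t s' k :
  exec p s t s' -> (size (rarr s' k) <= size (rarr s k) + t)%N.
Proof.
elim=> //=; try by move=> *; lia.
- by move=> {}s j a; rewrite /upd; case: eqP => [->|_]; rewrite ?size_rcons; lia.
- by move=> {}s j i a; rewrite /upd; case: eqP => [->|_]; rewrite ?size_put; lia.
Qed.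

Lemma set_nreg_input (R : realType) (G : stgraph R) (s y : 'I_(nv G)) l (eps : R) v :
  set_nreg (input s y l eps) 4 v = input s y v eps.
Proof. by congr Store; apply/funext => -[|[|[|[|[|?]]]]]. Qed.

(** [computes_tails] describes A only on inputs whose real register 0 holds 0, so B erases [eps]
    before calling A. *)
Lemma set_rreg_input (R : realType) (G : stgraph R) (s y : 'I_(nv G)) l (eps : R) v :
  set_rreg (input s y l eps) 0 v = input s y l v.
Proof. by congr Store; apply/funext => -[|?]. Qed.

(** The exponent is fixed when the program is built, so the cost of evaluation depends on [k] and
    [e] only, not on the instance. *)
Fixpoint rpow (e : rexp) (k : nat) : rexp :=
  if k is k'.+1 then RMul e (rpow e k') else ROfN (NLit 1).

Lemma reval_rpow (R : realType) (s : store R) e k :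
  reval s (rpow e k) = reval s e ^+ k.
Proof. by elim: k => //= k ->; rewrite exprS. Qed.

Definition ratio_exp : rexp := RDiv (ROfN (NVar 0)) (RVar 0).

Definition horizon_exp (c : nat) : rexp :=
  RMul (rpow (ROfN (NVar 0)) c.+1) (RLn ratio_exp).

(** With no floor operation, the ceiling of [e] is reached by counting in register 4, which is also
    where A expects [l]. *)
Definition count_up (e : rexp) : cmd :=
  While (BRLt (ROfN (NVar 4)) e) (SetN 4 (NAdd (NVar 4) (NLit 1))).

Lemma exec_count_up (R : realType) (G : stgraph R) (s y : 'I_(nv G)) (eps : R) e l :
    (forall i, (reval (input s y i eps) (ROfN (NVar 4)) <
                reval (input s y i eps) e) = (i < l)%N) ->
  exec (count_up e) (input s y 0 eps) (l * (rcost e + 8) + (rcost e + 4))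
       (input s y l eps).
Proof.
move=> lP; suff H i d : (i + d = l)%N ->
    exec (count_up e) (input s y i eps) (d * (rcost e + 8) + (rcost e + 4))
       (input s y l eps) by exact: H.
elim: d i => [|d IHd] i.
  rewrite addn0 => ->; rewrite mul0n add0n.
  have -> : (rcost e + 4 = (bcost (BRLt (ROfN (NVar 4)) e)).+1)%N by rewrite /=; lia.
  by apply: EWhileF; rewrite /= lP ltnn.
move=> idl; have -> : (d.+1 * (rcost e + 8) + (rcost e + 4) =
   (bcost (BRLt (ROfN (NVar 4)) e) + (ncost (NAdd (NVar 4) (NLit 1))).+1 +
    (d * (rcost e + 8) + (rcost e + 4))).+1)%N by rewrite /=; lia.
apply: EWhileT; [by rewrite /= lP; lia|exact: ESetN|].
by rewrite set_nreg_input; apply: IHd; rewrite /=; lia.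
Qed.

(** The loop is bounded by the size of the output array, since A may have overwritten register 4. *)
Definition sum_loop : cmd :=
  While (BNLt (NVar 0) (NSizeR 1))
    (Seq (SetR 1 (RAdd (RVar 1) (RGet 1 (NVar 0))))
         (SetN 0 (NAdd (NVar 0) (NLit 1)))).

Definition sum_tails : cmd :=
  Seq (SetN 0 (NLit 0)) (Seq (SetR 1 (ROfN (NLit 0))) sum_loop).

Lemma exec_sum_loop (R : realType) (s : store R) d :
    (nreg s 0 + d = size (rarr s 1))%N ->
  exists2 s', exec sum_loop s (d * 13 + 4) s' &
    real_output s' = rreg s 1 + \sum_(r <- drop (nreg s 0) (tail_output s)) r.
Proof.
elim: d s => [|d IHd] s ds.
  exists s; first by apply: (@EWhileF _ (BNLt (NVar 0) (NSizeR 1))); rewrite /=; lia.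
  by rewrite drop_oversize ?big_nil ?addr0//; rewrite /tail_output; lia.
set s1 := set_rreg s 1 (reval s (RAdd (RVar 1) (RGet 1 (NVar 0)))).
set s2 := set_nreg s1 0 (neval s1 (NAdd (NVar 0) (NLit 1))).
have [|s' ex_s' out_s'] := IHd s2; first by rewrite /= /upd /=; lia.
exists s'.
  have -> : (d.+1 * 13 + 4 = (bcost (BNLt (NVar 0) (NSizeR 1)) +
     ((rcost (RAdd (RVar 1) (RGet 1 (NVar 0)))).+1 +
      (ncost (NAdd (NVar 0) (NLit 1))).+1) + (d * 13 + 4)).+1)%N by rewrite /=; lia.
  apply: EWhileT ex_s'; first by rewrite /=; lia.
  by apply: ESeq; [exact: ESetR|exact: ESetN].
rewrite out_s' /s2 /s1 /tail_output /= /upd /= addn1 -addrA; congr +%R.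
have lt0 : (nreg s 0 < size (rarr s 1))%N by lia.
by rewrite [in RHS](drop_nth 0 lt0) big_cons.
Qed.

Lemma exec_sum_tails (R : realType) (s : store R) :
  exists2 s', exec sum_tails s (size (tail_output s) * 13 + 9) s' &
    real_output s' = \sum_(r <- tail_output s) r.
Proof.
set s1 := set_nreg s 0 0; set s2 := set_rreg s1 1 0.
have [|s' ex_s' out_s'] := @exec_sum_loop R s2 (size (tail_output s)) => //.
exists s'; last by rewrite out_s' /= /upd /= drop0 add0r.
have -> : (size (tail_output s) * 13 + 9 =
  2 + (3 + (size (tail_output s) * 13 + 4)))%N by lia.
apply: ESeq; first exact: ESetN.
by apply: ESeq ex_s'; exact: ESetR.
Qed.

(* z is the threshold on n/eps below which the constant truncation point L replaces the horizon. *)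
Definition approx_prog (c z L : nat) (A : cmd) : cmd :=
  Seq (If (BRLt ratio_exp (ROfN (NLit z))) (SetN 4 (NLit L))
          (count_up (horizon_exp c)))
  (Seq (SetR 0 (ROfN (NLit 0)))
  (Seq A sum_tails)).

Definition overhead (c : nat) : nat := (2 * rcost (horizon_exp c) + 60)%N.

Definition cutoff (R : realType) (c z L n : nat) (eps : R) : nat :=
  if n%:R / eps < z%:R then L else horizon c n eps.

Lemma ltr_ceil_nat (R : realType) (x : R) i : 0 <= x ->
  (i%:R < x) = (i < `|Num.ceil x|)%N.
Proof.
move=> x0; have c0 : 0 <= Num.ceil x by rewrite ceil_ge0; lra.
rewrite -ltz_nat gez0_abs// ltNge [RHS]ltNge; congr negb.
by rewrite -[i%:R]/((i%:Z)%:~R) ceil_le_int.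
Qed.

Lemma horizon_arg_ge0 (R : realType) c n (eps : R) : (0 < n)%N -> 0 < eps <= 1 ->
  0 <= n%:R ^+ c.+1 * ln (n%:R / eps) :> R.
Proof.
move=> n0 /andP[e0 e1]; rewrite mulr_ge0 ?exprn_ge0 ?ln_ge0//.
rewrite ler_pdivlMr// mul1r (le_trans e1)// ler1n//.
Qed.

(** Counting and summing take O([l]) steps, and [l <= t] because A writes [l] numbers; the constant
    part is absorbed by [t >= 1]. *)
Lemma exec_approx_prog (R : realType) c z L A (G : stgraph R) (s y : 'I_(nv G))
    (eps : R) t s1 (l := cutoff c z L (nv G) eps) :
    (0 < nv G)%N -> 0 < eps <= 1 ->
    exec A (input s y l 0) t s1 -> size (tail_output s1) = l ->
  exists t' s2, [/\ exec (approx_prog c z L A) (input s y 0 eps) t' s2,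
    real_output s2 = \sum_(r <- tail_output s1) r & (t' <= overhead c * t)%N].
Proof.
move=> n0 eps01 exA sz1.
have [s2 ex2 out2] := exec_sum_tails s1.
have t0 := exec_gt0 exA.
have lt_l : (l <= t)%N.
  by rewrite -sz1; apply: leq_trans (exec_size_rarr 1 exA) _.
have ex3 : exec (Seq A sum_tails) (input s y l 0)
    (t + (size (tail_output s1) * 13 + 9)) s2 by exact: ESeq ex2.
have ex4 : exec (SetR 0 (ROfN (NLit 0))) (input s y l eps) 3 (input s y l 0).
  by rewrite -(set_rreg_input s y l eps 0); exact: ESetR.
have [t5 ex5 t5le] : exists2 t5, exec (If (BRLt ratio_exp (ROfN (NLit z)))
    (SetN 4 (NLit L)) (count_up (horizon_exp c))) (input s y 0 eps) t5
    (input s y l eps) & (t5 <= l * (rcost (horizon_exp c) + 8) +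
      (rcost (horizon_exp c) + 20))%N.
  case: (boolP (beval (input s y 0 eps) (BRLt ratio_exp (ROfN (NLit z))))) => cond.
    eexists; first apply: EIfT => //.
      rewrite /l /cutoff; move: cond => /= ->.
      by rewrite -(set_nreg_input s y 0 eps L); exact: ESetN.
    by rewrite /=; lia.
  have lE : l = horizon c (nv G) eps.
    by rewrite /l /cutoff; move: cond => /= /negbTE ->.
  eexists; first apply: EIfF => //.
    apply: (exec_count_up (l := l)) => i.
    by rewrite /= reval_rpow /= -exprS ltr_ceil_nat ?horizon_arg_ge0// lE.
  by rewrite -/(horizon_exp c) [bcost _]/=; lia.
exists (t5 + (3 + (t + (size (tail_output s1) * 13 + 9))))%N, s2; split=> //.
  by apply: ESeq ex5 _; apply: ESeq ex4 _.
move: t5le; rewrite sz1 /overhead; set r := rcost _; clearbody r => t5le.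
apply: leq_trans (_ : l * (r + 8) + (r + 20) + (3 + (t + (l * 13 + 9))) <= _)%N.
  by rewrite leq_add2r.
have : (l * (r + 21) <= t * (r + 21))%N by rewrite leq_mul2r lt_l orbT.
have : (r <= r * t)%N by rewrite leq_pmulr.
nia.
Qed.

(** * Tails of the arrival time *)

Lemma ubnd_nneseries (R : realType) (u : nat -> \bar R) (m : nat) (b : \bar R) :
    (forall k, (m <= k)%N -> (0 <= u k)%E) ->
    (forall N, (\sum_(m <= k < N) u k <= b)%E) ->
  (\sum_(m <= k <oo) u k <= b)%E.
Proof.
move=> u0 ub; apply: lime_le; last exact: nearW.
by apply: is_cvg_nneseries => k mk _; exact: u0.
Qed.

Lemma geometric_tail_le (R : realFieldType) (b rho : R) (m N : nat) :
  0 <= b -> 0 <= rho < 1 ->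
  \sum_(m <= k < N) b * rho ^+ k <= b * rho ^+ m / (1 - rho).
Proof.
move=> b0 /andP[r0 r1].
have rN : 0 < 1 - rho by rewrite subr_gt0.
have [mN|Nm] := leqP m N; last first.
  rewrite big_geq ?(ltnW Nm)// !mulr_ge0 ?invr_ge0 ?exprn_ge0 ?(ltW rN)//.
rewrite ler_pdivlMr//.
suff -> : (\sum_(m <= k < N) b * rho ^+ k) * (1 - rho) = b * rho ^+ m - b * rho ^+ N.
  by rewrite lerBlDr lerDl mulr_ge0// exprn_ge0.
elim: N mN => [|N IHN]; first by rewrite leqn0 => /eqP->; rewrite big_geq// mul0r subrr.
rewrite leq_eqVlt => /orP[/eqP->|mN]; first by rewrite big_geq// mul0r subrr.
by rewrite big_nat_recr//= mulrDl IHN// exprS; ring.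
Qed.

Section Arrival.
Local Open Scope classical_set_scope.
Context (R : realType) (G : stgraph R).
Implicit Types (s y : 'I_(nv G)) (w : outcome G).

Definition arrives_by s y (j : nat) : set (outcome G) :=
  [set w | exists2 J, is_journey w s y J & (arrival J <= j)%N].

(** There are countably many candidates [J], and each of them requires only finitely many edge
    appearances. *)
Lemma measurable_arrives_by s y j : measurable (arrives_by s y j).
Proof.
have -> : arrives_by s y j =
    \bigcup_J ([set w | is_journey w s y J] `&` [set _ | (arrival J <= j)%N]).
  by apply/seteqP; split=> w /=; [move=> [J ? ?]; exists J|move=> [J _ []]; exists J].
apply: countable_bigcupT_measurable => [|J]; first exact: countableP.
apply: measurableI; last first.
  by have [?|?] := boolP (arrival J <= j)%N;
    [rewrite [X in measurable X](_ : _ = setT)|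
     rewrite [X in measurable X](_ : _ = set0)] => //; apply/seteqP; split=> //= w /negP.
have [[pathJ sortJ]|nJ] := pselect (is_path s y (unzip1 J) /\ sorted ltn (unzip2 J)); last first.
  rewrite [X in measurable X](_ : _ = set0)//.
  by apply/seteqP; split=> //= w [? ? _]; apply: nJ.
rewrite [X in measurable X](_ : _ = \bigcap_(et in [set` J])
    [set w | (0 < et.2)%N /\ et.1 \in snap et.2 w]); last first.
  by apply/seteqP; split=> w /=; [move=> [_ _]|split].
apply: fin_bigcap_measurable => // -[e t] _ /=.
(* Nothing is assumed about [snap 0], but the condition [0 < t] makes the event empty there. *)
have [t0|t0] := posnP t.
  by rewrite [X in measurable X](_ : _ = set0)//; apply/seteqP; split=> //= w; rewrite t0 => -[].
rewrite [X in measurable X](_ : _ = [set w | e \in snap t w]); first exact: snap_measurable.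
by apply/seteqP; split=> w //= -[].
Qed.

Lemma X_geP s y w (i : nat) :
  (i.+1%:R%:E <= X s y w)%E <-> ~ arrives_by s y i w.
Proof.
split=> [/ereal_infP Xge [J Jw]|nar].
  by rewrite leqNgt => /negP; apply; have := Xge _ (ex_intro2 _ _ J Jw erefl);
     rewrite lee_fin ler_nat.
apply/ereal_infP => _ [J Jw <-]; rewrite lee_fin ler_nat ltnNge.
by apply/negP => le_i; apply: nar; exists J.
Qed.

Lemma PrX_geE s y (i : nat) : PrX_ge s y i.+1 = law G (~` arrives_by s y i).
Proof. by congr (law G _); apply/seteqP; split=> w /= /X_geP. Qed.

(** A natural number [j] is the sum of the indicators of [i < j]. Without any journey, all
    indicators are 1 and both sides are infinite. *)
Lemma X_series s y w :
  (X s y w = \sum_(0 <= i <oo) (\1_(~` arrives_by s y i) w)%:E)%E.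
Proof.
have ind0 i : (0 <= (\1_(~` arrives_by s y i) w)%:E :> \bar R)%E.
  by rewrite lee_fin indicE.
have [[J0 J0w]|noJ] := pselect (exists J, is_journey w s y J); last first.
  have indE i : (\1_(~` arrives_by s y i) w)%:E = 1%E :> \bar R.
    by rewrite indicE mem_set//= => -[J Jw _]; apply: noJ; exists J.
  rewrite /X [S in ereal_inf S](_ : _ = set0) ?ereal_inf0; last first.
    by apply/seteqP; split=> //= x [J Jw _]; apply: noJ; exists J.
  apply/esym; apply: eq_infty => r; have /andP[_ rk] := truncn_itv (normr_ge0 r).
  apply: le_trans (nneseries_lim_ge (Num.truncn `|r|).+1 (fun i _ _ => ind0 i)).
  rewrite (eq_bigr (fun=> 1%E)) => [|i _]; last exact: indE.
  by rewrite sumEFin lee_fin sumr_const_nat subn0 (le_trans (ler_norm r))// ltW.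
have /ex_minnP[j /asboolP arj jmin] : exists j, `[< arrives_by s y j w >].
  by exists (arrival J0); apply/asboolP; exists J0.
have indE i : (\1_(~` arrives_by s y i) w)%:E = (i < j)%N%:R%:E :> \bar R.
  rewrite indicE; congr (_%:R%:E); congr nat_of_bool; apply/idP/idP.
    rewrite inE /= ltnNge => nar; apply/negP => ji; apply: nar.
    by have [J Jw Jj] := arj; exists J => //; apply: leq_trans ji.
  move=> ij; rewrite inE /= => ari; have := jmin i; rewrite leqNgt ij => /(_ _)/negP.
  by move/(_ (introT (asboolP _) ari)).
rewrite (nneseries_split 0 j)// add0n [X in (_ + X)%E]eseries0 ?adde0; last first.
  by move=> i ji _; rewrite indE ltnNge ji.
rewrite big_nat (eq_bigr (fun=> 1%E)); last by move=> i /andP[_ ij]; rewrite indE ij.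
rewrite -big_nat /=.
rewrite sumEFin sumr_const_nat subn0; apply/le_anti/andP; split.
  have [J Jw Jj] := arj; apply: le_trans (_ : (arrival J)%:R%:E <= _)%E.
    by apply: ereal_inf_lbound; exists J.
  by rewrite lee_fin ler_nat.
apply/ereal_infP => _ [J Jw <-]; rewrite lee_fin ler_nat; apply: jmin.
by apply/asboolP; exists J.
Qed.

(** Termwise integration of a nonnegative series, which is valid even when the expectation is
    infinite. *)
Lemma EX_series s y :
  (EX s y = \sum_(0 <= i <oo) law G (~` arrives_by s y i))%E.
Proof.
have mA i := measurableC (measurable_arrives_by s y i).
rewrite /EX; under eq_integral do rewrite X_series.
rewrite integral_nneseries//; last first.
  by move=> i; apply/measurable_EFinP; exact: measurable_indic.
by apply: eq_eseriesr => i _; rewrite integral_indic// setIT.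
Qed.


(* The greedy traversal of es, which crosses the next edge as soon as it appears, is not finished
   after the j snapshots following time a. *)
Fixpoint stuck (es : seq 'I_(ne G)) (a j : nat) w : bool :=
  if es is e :: es' then
    if j is j'.+1 then stuck (if e \in snap a.+1 w then es' else es) a.+1 j' w
    else true
  else false.

(** The witnesses are the crossing times; they increase strictly because at most one edge is crossed
    per snapshot. *)
Lemma unstuck_times es a j w : ~~ stuck es a j w ->
  exists ts, [/\ size ts = size es, path ltn a ts, (last a ts <= a + j)%N &
    all (fun et => et.1 \in snap et.2 w) (zip es ts)].
Proof.
elim: j es a => [|j IHj] [|e es] a //=; try by exists [::]; rewrite leq_addr.
case: ifP => [e_in|_] /IHj[ts [szts pts lts snts]].
  by exists (a.+1 :: ts); rewrite /= szts ltnSn pts e_in -addSnnS.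
case: ts szts pts lts snts => [//|t ts] /= szts /andP[at_ pts] lts snts.
by exists (t :: ts); rewrite /= -addSnnS (ltnW at_).
Qed.

(** A finished greedy traversal, zipped with its crossing times, is itself a journey. *)
Lemma stuck_not_arrives s y es j w :
  is_path s y es -> ~ arrives_by s y j w -> stuck es 0 j w.
Proof.
move=> path_es nar; apply/negPn/negP => /unstuck_times[ts [szts pts lts snts]].
have z1 : unzip1 (zip es ts) = es by rewrite unzip1_zip ?szts.
have z2 : unzip2 (zip es ts) = ts by rewrite unzip2_zip ?szts.
apply: nar; exists (zip es ts); last by rewrite /arrival z2.
split; [by rewrite z1|by rewrite z2 (path_sorted pts)|move=> et et_in; split].
  apply: (allP (order_path_min ltn_trans pts)).
  by rewrite -z2; apply: map_f.
exact: (allP snts).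
Qed.

(** The tail of a sum of independent geometric waiting times, one per edge, computed by conditioning
    on the first snapshot. *)
Fixpoint stuck_prob (es : seq 'I_(ne G)) (j : nat) : R :=
  if es is e :: es' then
    if j is j'.+1 then prob e * stuck_prob es' j' + (1 - prob e) * stuck_prob es j'
    else 1
  else 0.

Let present (et : 'I_(ne G) * nat) : set (outcome G) :=
  [set w | et.1 \in snap et.2 w].

Lemma measurable_stuck es a j : measurable [set w | stuck es a j w].
Proof.
elim: j es a => [|j IHj] [|e es] a /=.
- by rewrite [X in measurable X](_ : _ = set0)//; apply/seteqP; split.
- by rewrite [X in measurable X](_ : _ = setT)//; apply/seteqP; split.
- by rewrite [X in measurable X](_ : _ = set0)//; apply/seteqP; split.
rewrite [X in measurable X](_ : _ =
    (present (e, a.+1) `&` [set w | stuck es a.+1 j w]) `|`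
    ([set w | stuck (e :: es) a.+1 j w] `\` present (e, a.+1))).
  have mA : measurable (present (e, a.+1)) by exact: snap_measurable.
  by apply: measurableU; [apply: measurableI|apply: measurableD].
apply/seteqP; split=> w /=; rewrite /present /=.
  by case: ifP => [|/negP]; [left|right].
by case=> [[->]//|[st /negP/negbTE->]].
Qed.

(* Intersecting with a cylinder on the past makes the induction on j go through with only the
   product rule for positive events. *)
Lemma law_stuck es a j (F : {fset 'I_(ne G) * nat}) :
    (forall et, et \in F -> (0 < et.2 <= a)%N) ->
  law G ((\bigcap_(et in [set` F]) present et) `&` [set w | stuck es a j w]) =
  ((\prod_(et <- F) prob et.1) * stuck_prob es j)%:E.
Proof.
have mpresent et : (0 < et.2)%N -> measurable (present et).
  by case: et => e t t0; exact: snap_measurable.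
have lawF b (H : {fset 'I_(ne G) * nat}) : (forall et, et \in H -> (0 < et.2 <= b)%N) ->
    law G (\bigcap_(et in [set` H]) present et) = (\prod_(et <- H) prob et.1)%:E.
  move=> Hb; rewrite (@snap_indep _ G H); last by move=> et /= /Hb /andP[].
  rewrite (big_morph EFin EFinM erefl); apply: eq_big_seq => -[e t] /Hb /andP[t0 _].
  exact: snap_prob.
elim: j es a F => [|j IHj] [|e es] a F Fa /=.
- by rewrite mulr0 -[RHS](@measure0 _ _ _ (law G)); congr (law G _); apply/seteqP; split=> w //= [].
- by rewrite mulr1 -(lawF a)//; congr (law G _); apply/seteqP; split=> w //= [].
- by rewrite mulr0 -[RHS](@measure0 _ _ _ (law G)); congr (law G _); apply/seteqP; split=> w //= [].
set C := \bigcap_(et in _) _; set A := present (e, a.+1).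
(* All times in [F] are at most [a], so the event at time [a.+1] is new and [F'] is a cylinder on
   the past of [a.+1]. *)
pose F' := ((e, a.+1) |` F)%fset.
have FaS et : et \in F -> (0 < et.2 <= a.+1)%N.
  by move=> /Fa /andP[-> /= /leqW].
have F'a et : et \in F' -> (0 < et.2 <= a.+1)%N.
  by rewrite in_fset1U => /orP[/eqP-> /=|/FaS]; rewrite ?leqnn.
have CF' : \bigcap_(et in [set` F']) present et = A `&` C.
  apply/seteqP; split=> w /=.
    move=> Fw; split; first by apply: Fw; rewrite /= in_fset1U eqxx.
    by move=> et etF; apply: Fw; rewrite /= in_fset1U; apply/orP; right.
  by move=> [Aw Cw] et /=; rewrite in_fset1U => /orP[/eqP->//|]; exact: Cw.
have eaF : (e, a.+1) \notin F.
  by apply/negP => /Fa; rewrite /= ltnn.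
have prodF' : \prod_(et <- F') prob et.1 = prob e * \prod_(et <- F) prob et.1.
  by rewrite big_fsetU1.
have mA : measurable A by exact: mpresent.
have mC : measurable C.
  by apply: fin_bigcap_measurable => // et /Fa /andP[t0 _]; exact: mpresent.
rewrite (measureDI _ _ mA); last first.
  by apply: measurableI => //; exact: (measurable_stuck (e :: es) a j.+1).
rewrite [X in (_ + law G X)%E](_ : _ =
    (A `&` C) `&` [set w | stuck es a.+1 j w]); last first.
  apply/seteqP; split=> w /=; rewrite /A /present /=.
    by move=> [[Cw st] ew]; rewrite ew in st.
  by move=> [[ew Cw] st]; rewrite ew.
rewrite [X in (law G X + _)%E](_ : _ =
    (C `&` [set w | stuck (e :: es) a.+1 j w]) `\` A); last first.
  apply/seteqP; split=> w; rewrite /A /present /=.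
    by move=> [[Cw st] /negP ew]; rewrite (negbTE ew) in st; split=> //; apply/negP.
  by move=> [[Cw st] /negP ew]; rewrite (negbTE ew).
have mS : measurable (C `&` [set w | stuck (e :: es) a.+1 j w]).
  by apply: measurableI => //; exact: measurable_stuck.
(* The absence of [e] is handled by subtraction, so that only the cylinders [F] and [F'] occur in
   the induction hypothesis. *)
have -> : law G ((C `&` [set w | stuck (e :: es) a.+1 j w]) `\` A) =
    (law G (C `&` [set w | stuck (e :: es) a.+1 j w]) -
     law G (C `&` [set w | stuck (e :: es) a.+1 j w] `&` A))%E.
  by rewrite measureD// ltey_eq fin_num_measure.
rewrite [C `&` _ `&` A]setIAC [C `&` A]setIC -CF'.
rewrite (IHj _ _ _ FaS) !(IHj _ _ _ F'a) prodF' -EFinB -EFinD; congr EFin.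
ring.
Qed.

(** An unfinished state has an edge left and so weighs at least [x]. The factor [x] on the left
    records this and later saves one power of [x]. A probability larger than [p] only strengthens
    the contraction. *)
Lemma stuck_prob_le (p x : R) es j : 1 <= x -> 0 <= p <= 1 ->
    (forall e : 'I_(ne G), p <= prob e <= 1) ->
  x * stuck_prob es j <= x ^+ size es * (1 - p * (1 - x^-1)) ^+ j.
Proof.
move=> x1 /andP[p0 p1] pP; set rho := 1 - _.
have x0 : 0 < x by lra.
have xV : 0 < x^-1 <= 1 by rewrite invr_gt0 x0 invf_le1.
have rho0 : 0 <= rho.
  by rewrite /rho; nra.
elim: j es => [|j IHj] [|e es] /=.
- by rewrite mulr0 expr0 mul1r.
- by rewrite expr0 !mulr1 exprS ler_peMr ?exprn_ege1 ?(ltW x0).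
- by rewrite mulr0 mulr_ge0// exprn_ge0.
have /andP[pe e1] := pP e.
have IH1 := IHj es; have := IHj (e :: es); rewrite /= exprS => IH2.
have y0 : 0 <= x ^+ size es * rho ^+ j by rewrite mulr_ge0// exprn_ge0// ltW.
apply: le_trans (_ : prob e * (x ^+ size es * rho ^+ j) +
  (1 - prob e) * (x * x ^+ size es * rho ^+ j) <= _).
  rewrite mulrDr [x * (_ * _)]mulrCA [x * ((1 - _) * _)]mulrCA lerD//.
    by rewrite ler_wpM2l//; lra.
  by rewrite ler_wpM2l//; lra.
rewrite [rho ^+ j.+1]exprS.
have -> : prob e * (x ^+ size es * rho ^+ j) +
  (1 - prob e) * (x * x ^+ size es * rho ^+ j) =
  (x ^+ size es * rho ^+ j) * (x * (1 - prob e * (1 - x^-1))).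
  by field; rewrite gt_eqF.
have -> : x * x ^+ size es * (rho * rho ^+ j) =
  (x ^+ size es * rho ^+ j) * (x * rho) by ring.
by rewrite ler_wpM2l// ler_wpM2l ?(ltW x0)// /rho lerB// ler_wpM2r//; lra.
Qed.

(** The error is exactly the omitted part of the series for the expectation, and this is dominated
    by a geometric series of ratio [rho], where [1 - rho = p * (1 - x^-1)]. *)
Lemma truncation_error s y es (p x : R) l (tails : seq R) :
    is_path s y es -> es != [::] -> 0 < p -> 1 < x ->
    (forall e : 'I_(ne G), p <= prob e) ->
    [seq r%:E | r <- tails] = [seq PrX_ge s y i | i <- iota 1 l] ->
  (`|(\sum_(r <- tails) r)%:E - EX s y| <=
   (x ^+ (size es).-1 * (1 - p * (1 - x^-1)) ^+ l / (p * (1 - x^-1)))%:E)%E.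
Proof.
move=> path_es es0 p0 x1 pP tailsE; set rho := 1 - _.
have x0 : 0 < x by lra.
have xV : 0 < x^-1 < 1 by rewrite invr_gt0 x0 invf_lt1.
have prob1 (e : 'I_(ne G)) : prob e <= 1.
  by rewrite -lee_fin -(@snap_prob _ G e 1)// probability_le1//; exact: snap_measurable.
have pxV : 0 < p * (1 - x^-1) by rewrite mulr_gt0//; lra.
have p1 : p <= 1.
  (* A nonempty path supplies an edge, whose probability lies between [p] and 1. *)
  by case: es es0 {path_es} => // e _ _; apply: le_trans (pP e) (prob1 e).
have rho01 : 0 <= rho < 1 by rewrite /rho; nra.
have sumE : (\sum_(r <- tails) r)%:E =
    (\sum_(0 <= i < l) law G (~` arrives_by s y i))%E.
  rewrite -sumEFin -(big_map EFin xpredT id) tailsE big_map.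
  rewrite -[1%N]/(1 + 0)%N iotaDl big_map /index_iota subn0.
  by apply: eq_bigr => i _; rewrite add1n PrX_geE.
have lawle i : (law G (~` arrives_by s y i) <=
    (x ^+ (size es).-1 * rho ^+ i)%:E)%E.
  have mst : measurable [set w | stuck es 0 i w] by exact: measurable_stuck.
  apply: le_trans (_ : law G [set w | stuck es 0 i w] <= _)%E.
    apply: le_measure; rewrite ?inE//.
      by apply: measurableC; exact: measurable_arrives_by.
    by move=> w; exact: stuck_not_arrives.
  (* The empty cylinder gives the law of the traversal itself. *)
  have := @law_stuck es 0 i fset0; rewrite big_seq_fset0 mul1r.
  rewrite set_fset0 bigcap_set0 setTI => -> //; rewrite lee_fin.
  rewrite -(ler_pM2l x0) mulrA -exprS prednK ?lt0n ?size_eq0//.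
  by apply: stuck_prob_le => [||e]; [exact: ltW|by rewrite p1 ltW|by rewrite pP prob1].
rewrite EX_series (nneseries_split 0 l)// add0n -sumE.
set tl := (\sum_(l <= k <oo) _)%E.
have tl0 : (0 <= tl)%E by apply: nneseries_ge0.
have tlb : (tl <= (x ^+ (size es).-1 * rho ^+ l / (1 - rho))%:E)%E.
  apply: ubnd_nneseries => // N.
  apply: le_trans (_ : \sum_(l <= k < N) (x ^+ (size es).-1 * rho ^+ k)%:E <= _)%E.
    by apply: lee_sum => i _.
  by rewrite sumEFin lee_fin geometric_tail_le// exprn_ge0// ltW.
(* Cancelling the partial sum in the extended reals requires the omitted part to be finite. *)
have tlfin : tl \is a fin_num by rewrite ge0_fin_numE// (le_lt_trans tlb)// ltry.
rewrite -[p * _](_ : 1 - rho = _); last by rewrite /rho; ring.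
move: tl0 tlb; rewrite -(fineK tlfin) -EFinD abse_EFin !lee_fin => tl0 tlb.
by rewrite opprD addrA subrr add0r normrN ger0_norm.
Qed.

End Arrival.

(** * Truncation points *)

Section Bounds.
Context (R : realType).
Implicit Types (x eps z : R).

(** From [expR (- (1 / 2)) >= 1 / 2] follows [expR (1 / 2) <= 2], which is then squared. *)
Lemma expR1_le4 : expR 1 <= 4 :> R.
Proof.
have h : 1 / 2 <= expR (- (1 / 2)) :> R by have := expR_ge1Dx (- (1 / 2) : R); lra.
have e0 : 0 < expR (1 / 2) :> R by exact: expR_gt0.
have hm : expR (1 / 2) * expR (- (1 / 2)) = 1 :> R by rewrite expRN divff ?gt_eqF.
have e2 : expR (1 / 2) <= 2 :> R by nra.
rewrite (_ : 1 = 1 / 2 + 1 / 2 :> R); last by field.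
by rewrite expRD; nra.
Qed.

(** Split [ln x = ln (x / 2) + ln 2] and bound the two terms by [x / 2 - 1] and 1. *)
Lemma ln_sqr_le x : 0 < x -> ln (x ^+ 2) <= x.
Proof.
move=> x0; rewrite lnXn// -mulr_natl.
have half : 0 < x / 2 by rewrite divr_gt0.
have h1 : ln (x / 2) <= x / 2 - 1.
  have := @le_ln1Dx R (x / 2 - 1); rewrite [1 + _]addrC subrK; apply; lra.
have h2 : ln 2 <= 1 :> R by have := @le_ln1Dx R 1; rewrite (_ : 1 + 1 = 2 :> R) //; apply; lra.
have -> : ln x = ln (x / 2) + ln 2 by rewrite -lnM ?posrE// divfK.
by lra.
Qed.

Lemma horizon_ge c n eps : (0 < n)%N -> 0 < eps <= 1 ->
  n%:R ^+ c.+1 * ln (n%:R / eps) <= (horizon c n eps)%:R.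
Proof.
move=> n0 eps01; rewrite leNgt ltr_ceil_nat ?ltnn//; exact: horizon_arg_ge0.
Qed.

Lemma horizon_gt0 c n eps : (1 < n)%N -> 0 < eps <= 1 -> (0 < horizon c n eps)%N.
Proof.
move=> n1 eps01; rewrite -ltr_ceil_nat ?horizon_arg_ge0 ?(ltnW n1)//.
have /andP[e0 e1] := eps01.
rewrite mulr_gt0 ?exprn_gt0 ?ltr0n ?(ltnW n1)// ln_gt0// ltr_pdivlMr// mul1r.
by rewrite (le_lt_trans e1)// ltr1n.
Qed.

Lemma horizon_le c n eps : (1 < n)%N -> 0 < eps <= 1 ->
  (horizon c n eps)%:R <= n%:R ^+ c.+2 * eps^-1 + 1.
Proof.
move=> n1 eps01; have /andP[e0 e1] := eps01.
have h0 := horizon_gt0 c n1 eps01.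
have : (horizon c n eps).-1%:R < n%:R ^+ c.+1 * ln (n%:R / eps).
  by rewrite ltr_ceil_nat ?horizon_arg_ge0 ?(ltnW n1)// prednK.
rewrite -[X in X%:R <= _](prednK h0) -natr1 => hlt.
rewrite lerD2r (le_trans (ltW hlt))// [_ ^+ c.+2]exprSr -mulrA.
have z0 : 0 < n%:R / eps by rewrite divr_gt0// ltr0n (ltnW n1).
by rewrite ler_wpM2l ?exprn_ge0// ltW// ln_sublinear.
Qed.

(* The choice x = sqrt (n / eps) balances the factor x ^+ (k - 1) against the exponential decay. *)
Lemma horizon_tail_lt c n k eps (x := Num.sqrt (n%:R / eps)) (p := 1 / n%:R ^+ c) :
    (1 < n)%N -> (0 < k < n)%N -> 0 < eps <= 1 -> (4 ^ c.+2)%:R <= n%:R / eps ->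
  x ^+ k.-1 * (1 - p * (1 - x^-1)) ^+ horizon c n eps / (p * (1 - x^-1)) < eps.
Proof.
move=> n1 /andP[k0 kn] eps01.
have kn2 : (k.-1 <= n - 2)%N by lia.
move=> zge; have /andP[e0 e1] := eps01.
set l := horizon _ _ _; set N : R := n%:R in x p zge *.
have N2 : 2 <= N by rewrite ler_nat.
have z0 : 0 < N / eps by rewrite divr_gt0//; lra.
have x0 : 0 < x by rewrite sqrtr_gt0.
have x2 : x ^+ 2 = N / eps by rewrite sqr_sqrtr// ltW.
(* The threshold [4 ^ c.+2] is the square of [4 * 2 ^ c]. *)
have xge : 4 * 2 ^+ c <= x.
  rewrite -(ler_pXn2r (n := 2)) ?nnegrE ?mulr_ge0 ?exprn_ge0 ?(ltW x0)// x2.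
  apply: le_trans zge; rewrite natrX exprMn -exprM mulnC exprM.
  have -> : 2 ^+ 2 = 4 :> R by rewrite expr2 -natrM.
  by rewrite -exprD.
clear zge.
have x4 : 4 <= x by have : 1 <= 2 ^+ c :> R by [rewrite exprn_ege1// ler1n]; lra.
have u0 : 0 < x^-1 <= 1 / 4.
  by rewrite invr_gt0 x0 -[x^-1]mul1r ler_pdivrMr//; lra.
have P0 : 0 < N ^+ c by rewrite exprn_gt0//; lra.
have p0 : 0 < p by rewrite divr_gt0.
have p1 : p <= 1 by rewrite ler_pdivrMr// mul1r exprn_ege1//; lra.
have pP : p * N ^+ c = 1 by rewrite divfK// gt_eqF.
have xx : x * x^-1 = 1 by rewrite divff// gt_eqF.
(* By [1 - u <= expR (- u)], the power is at most the exponential of [- p * (1 - x^-1) * l]. Here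
   [p * l >= N * ln (x ^+ 2)], and [x^-1 * ln (x ^+ 2) <= 1] makes the loss from the factor
   [1 - x^-1] at most [N]. Finally [expR 1] is rounded up to 4. *)
have powl : (1 - p * (1 - x^-1)) ^+ l <= (4 / x ^+ 2) ^+ n.
  apply: le_trans (_ : expR (N * (1 - ln (x ^+ 2))) <= _).
    apply: le_trans (_ : expR (- (p * (1 - x^-1))) ^+ l <= _).
      apply: lerXn2r; rewrite ?nnegrE ?expR_ge0//; first nra.
      by have := expR_ge1Dx (- (p * (1 - x^-1))).
    rewrite -expRM_natl ler_expR.
    have hl : N * (N ^+ c * ln (x ^+ 2)) <= l%:R.
      by rewrite mulrA -exprS x2; apply: horizon_ge => //; exact: ltnW.
    have hx : ln (x ^+ 2) <= x by exact: ln_sqr_le.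
    have hp : N * ln (x ^+ 2) <= p * l%:R.
      by rewrite (le_trans _ (ler_wpM2l (ltW p0) hl))// mulrCA [p * (_ * _)]mulrA pP mul1r.
    have : (1 - x^-1) * (N * ln (x ^+ 2)) <= (1 - x^-1) * (p * l%:R).
      by rewrite ler_wpM2l//; lra.
    have : x^-1 * ln (x ^+ 2) <= 1 by rewrite -xx mulrC ler_wpM2r//; lra.
    nra.
  rewrite expRM_natl; apply: lerXn2r; rewrite ?nnegrE ?expR_ge0//.
    by rewrite divr_ge0// sqr_ge0.
  rewrite expRD expRN lnK ?posrE ?exprn_gt0//.
  by rewrite ler_wpM2r ?expR1_le4// invr_ge0 sqr_ge0.
have xk : x ^+ k.-1 <= x ^+ (n - 2) by apply: ler_weXn2l => //; lra.
(* Each factor [4 / x] is at most [2 ^- c], and [n < 2 ^ n]; this is where the threshold grows with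
   [c]. *)
have small : (4 / x) ^+ n * N ^+ c <= 1.
  have h4 : 4 / x <= (2 ^+ c)^-1.
    by rewrite ler_pdivrMr// mulrC ler_pdivlMr// exprn_gt0.
  apply: le_trans (_ : ((2 ^+ c)^-1) ^+ n * (2 ^+ n) ^+ c <= _).
    have q0 : 0 <= 4 / x by rewrite divr_ge0// ltW.
    have N0 : 0 <= N by lra.
    apply: ler_pM; [exact: exprn_ge0|exact: exprn_ge0| |].
      by apply: lerXn2r; rewrite // nnegrE invr_ge0 exprn_ge0.
    apply: lerXn2r; rewrite ?nnegrE ?exprn_ge0//.
    by rewrite -natrX ler_nat ltnW// ltn_expl.
  by rewrite exprVn -!exprM mulnC mulVf// gt_eqF// exprn_gt0.
have y0 : 0 < p * (1 - x^-1) by rewrite mulr_gt0//; lra.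
rewrite ltr_pdivrMr//.
apply: le_lt_trans (_ : x ^+ (n - 2) * (4 / x ^+ 2) ^+ n < _).
  apply: ler_pM => //; rewrite exprn_ge0 ?(ltW x0)//; nra.
have -> : x ^+ (n - 2) * (4 / x ^+ 2) ^+ n = (4 / x) ^+ n * x^-1 ^+ 2.
  rewrite [x ^+ 2]expr2 invfM mulrA exprMn.
  have -> : x^-1 ^+ n = x^-1 ^+ (n - 2) * x^-1 ^+ 2 by rewrite -exprD subnK.
  by rewrite mulrCA [x ^+ (n - 2) * _]mulrA -exprMn xx expr1n mul1r.
(* Since [eps = N / x ^+ 2], the factor [x^-1 ^+ 2] cancels. What remains is
   [(4 / x) ^+ n < N * (p * (1 - x^-1))], where the left side is at most [p] and
   [N * (1 - x^-1) >= 3 / 2]. *)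
have ex2 : eps = N * x^-1 ^+ 2.
  have Nn0 : N != 0 by rewrite gt_eqF//; lra.
  by rewrite exprVn x2 invf_div mulrC divfK.
rewrite ex2 mulrAC ltr_pM2r; last by rewrite exprn_gt0// invr_gt0.
have qp : (4 / x) ^+ n <= p by rewrite ler_pdivlMr.
have : 3 / 2 <= N * (1 - x^-1) by nra.
rewrite mulrCA => Nu; apply: le_lt_trans qp _.
by rewrite -[X in X < _]mulr1 ltr_pM2l//; lra.
Qed.

(** The weight is [x = 2], and [Z] stands in for the number of vertices, the exponent of [x] and
    [1 / eps] at once. A limit argument suffices, as [L] is a constant of the program. *)
Lemma exists_cutoff c (Z : nat) : (0 < Z)%N ->
  let p : R := 1 / Z%:R ^+ c in
  exists2 L, (0 < L)%N &
    2 ^+ Z * (1 - p * (1 - 2^-1)) ^+ L / (p * (1 - 2^-1)) < Z%:R^-1 :> R.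
Proof.
move=> Z0 p; set rho := 1 - _; set b := p * _.
have p0 : 0 < p by rewrite divr_gt0// exprn_gt0// ltr0n.
have p1 : p <= 1 by rewrite ler_pdivrMr ?exprn_gt0 ?ltr0n// mul1r exprn_ege1// ler1n.
have b0 : 0 < b by rewrite /b; nra.
have rho1 : `|rho| < 1 by rewrite ger0_norm /rho; nra.
have e0 : 0 < Z%:R^-1 * b :> R by rewrite mulr_gt0// invr_gt0 ltr0n.
have /cvgrPdist_lt/(_ _ e0)[L _ LP] := cvg_geometric (2 ^+ Z) rho1.
exists L.+1 => //; rewrite ltr_pdivrMr//.
have := LP L.+1 (leqnSn L); rewrite /= sub0r normrN.
exact: le_lt_trans (ler_norm _).
Qed.

End Bounds.

(** * Lengths of paths and number of edges *)

Section GraphSize.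
Context (R : realType) (G : stgraph R).
Implicit Types s y : 'I_(nv G).

Lemma walk_size s es vs : walk s es vs -> size es = size vs.
Proof.
by elim: es s vs => [|e es IHes] s [|v vs] //= /andP[_ /IHes ->].
Qed.

(** The vertices of a path are distinct and one more than its edges; [s != y] rules out the empty
    path. *)
Lemma path_size s y es : s != y -> is_path s y es -> (0 < size es < nv G)%N.
Proof.
move=> sy [vs [/walk_size szvs uvs lst]]; rewrite szvs lt0n size_eq0.
have := max_card (mem (s :: vs)); rewrite (card_uniqP uvs) card_ord /= => ->.
by case: vs lst {szvs uvs} => // sy'; rewrite -sy' /= eqxx in sy.
Qed.

Lemma ne_le : (ne G <= nv G * nv G)%N.
Proof.
have inj : injective (fun e : 'I_(ne G) => (src e, dst e)).
  by move=> e e' /= ee'; apply: no_parallel; left.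
by have := leq_card _ inj; rewrite card_prod !card_ord.
Qed.

End GraphSize.

(** * Functions bounded by a power of a given quantity *)

Section PolynomialGrowth.
Context (R : realType) (T : Type) (y : T -> R) (y_ge1 : forall t, 1 <= y t).

(** A polynomial may have negative coefficients and fail to be monotone, so upper bounds on its
    arguments cannot be substituted directly; bounds on absolute values are stable under sums and
    products. *)
Definition poly_bounded (g : T -> R) : Prop :=
  exists2 M : R, 0 <= M & exists D, forall t, `|g t| <= M * y t ^+ D.

Let y_ge0 t : 0 <= y t. Proof. exact: le_trans (y_ge1 t). Qed.

Lemma poly_bounded_cst a : poly_bounded (fun=> a).
Proof. by exists `|a| => //; exists 0%N => t; rewrite mulr1. Qed.

Lemma poly_boundedD g h :
  poly_bounded g -> poly_bounded h -> poly_bounded (fun t => g t + h t).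
Proof.
move=> [M M0 [D gD]] [N N0 [E hE]]; exists (M + N); first exact: addr_ge0.
exists (D + E)%N => t; apply: le_trans (ler_normD _ _) _; rewrite mulrDl lerD//.
  by rewrite (le_trans (gD t))// ler_wpM2l// ler_weXn2l// leq_addr.
by rewrite (le_trans (hE t))// ler_wpM2l// ler_weXn2l// leq_addl.
Qed.

Lemma poly_boundedM g h :
  poly_bounded g -> poly_bounded h -> poly_bounded (fun t => g t * h t).
Proof.
move=> [M M0 [D gD]] [N N0 [E hE]]; exists (M * N); first exact: mulr_ge0.
by exists (D + E)%N => t; rewrite normrM exprD mulrACA ler_pM.
Qed.

Context (g1 g2 g3 : T -> R) (g1_bounded : poly_bounded g1) (g2_bounded : poly_bounded g2)
  (g3_bounded : poly_bounded g3).

Lemma poly_bounded_horner (q : {poly R}) : poly_bounded (fun t => q.[g3 t]).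
Proof.
elim/poly_ind: q => [|q c IHq].
  by under [fun t => _]funext do rewrite horner0; exact: poly_bounded_cst.
under [fun t => _]funext do rewrite hornerMXaddC.
by apply: poly_boundedD (poly_bounded_cst c); exact: poly_boundedM.
Qed.

Lemma poly_bounded_horner2 (q : {poly {poly R}}) :
  poly_bounded (fun t => q.[(g2 t)%:P].[g3 t]).
Proof.
elim/poly_ind: q => [|q c IHq].
  by under [fun t => _]funext do rewrite !horner0; exact: poly_bounded_cst.
under [fun t => _]funext do rewrite hornerMXaddC hornerD hornerM hornerC.
by apply: poly_boundedD (poly_bounded_horner c); exact: poly_boundedM.
Qed.

Lemma poly_bounded_horner3 (q : {poly {poly {poly R}}}) :
  poly_bounded (fun t => q.[(g1 t)%:P%:P].[(g2 t)%:P].[g3 t]).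
Proof.
elim/poly_ind: q => [|q c IHq].
  by under [fun t => _]funext do rewrite !horner0; exact: poly_bounded_cst.
under [fun t => _]funext do rewrite hornerMXaddC !hornerD !hornerM !hornerC.
by apply: poly_boundedD (poly_bounded_horner2 c); exact: poly_boundedM.
Qed.

End PolynomialGrowth.

(** * Error of the truncated sum *)

Section Correctness.
Context (R : realType) (c : nat) (G : stgraph R) (s y : 'I_(nv G)) (eps : R)
  (sy : s != y) (eps01 : 0 < eps <= 1)
  (probP : forall e : 'I_(ne G), 1 / (nv G)%:R ^+ c <= prob e).

Lemma cutoff_error es (Z L : nat) (tails : seq R) :
    is_path s y es -> (4 ^ c.+2 <= Z)%N ->
    (let p : R := 1 / Z%:R ^+ c in
     2 ^+ Z * (1 - p * (1 - 2^-1)) ^+ L / (p * (1 - 2^-1)) < Z%:R^-1) ->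
    [seq r%:E | r <- tails] =
      [seq PrX_ge s y i | i <- iota 1 (cutoff c Z L (nv G) eps)] ->
  (`|(\sum_(r <- tails) r)%:E - EX s y| < eps%:E)%E.
Proof.
move=> path_es Zge Lsmall; have /andP[e0 e1] := eps01.
have /andP[k0 kn] := path_size sy path_es.
have n1 : (1 < nv G)%N by exact: leq_ltn_trans kn.
have n0 : 0 < (nv G)%:R :> R by rewrite ltr0n ltnW.
have es0 : es != [::] by rewrite -size_eq0 -lt0n.
rewrite /cutoff; case: ltP => [zlt|zge] tailsE.
(* Below the threshold, [Z] exceeds both the number of vertices and [1 / eps], so the error bound
   for [x = 2] is at most the one that [L] was chosen for. *)
- have Z0 : 0 < Z%:R :> R by rewrite (le_lt_trans _ zlt)// divr_ge0// ltW.
  have nZ : (nv G)%:R <= Z%:R :> R.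
    apply: ltW (le_lt_trans _ zlt); rewrite ler_pdivlMr// ler_piMr//.
  set p : R := 1 / Z%:R ^+ c in Lsmall.
  have p0 : 0 < p by rewrite divr_gt0// exprn_gt0.
  have pP (e : 'I_(ne G)) : p <= prob e.
    apply: le_trans (probP e).
    rewrite ler_pdivlMr ?exprn_gt0// mulrC mulrA mulr1 ler_pdivrMr ?exprn_gt0// mul1r.
    by apply: lerXn2r => //; rewrite nnegrE ltW.
  have := truncation_error path_es es0 p0 _ pP tailsE (x := 2).
  rewrite ltr1n => /(_ isT) err; apply: le_lt_trans err _; rewrite lte_fin.
  have ng1 : (Z%:R)^-1 < eps.
    rewrite -[_^-1]mul1r ltr_pdivrMr// mulrC -ltr_pdivrMr//.
    by apply: le_lt_trans zlt; rewrite ler_pM2r ?invr_gt0// ler1n ltnW.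
  apply: lt_trans ng1; apply: le_lt_trans Lsmall.
  have p1 : p <= 1.
    rewrite ler_pdivrMr ?exprn_gt0// mul1r exprn_ege1// (le_trans _ nZ)//.
    by rewrite ler1n ltnW.
  have b0 : 0 < p * (1 - 2^-1) < 1 by nra.
  rewrite ler_pM2r ?invr_gt0; last by case/andP: b0.
  rewrite ler_wpM2r ?exprn_ge0//; first by lra.
  rewrite ler_weXn2l ?ler1n// (leq_trans (leq_pred _))//.
  by rewrite (leq_trans (ltnW kn))// -(ler_nat R).
- have p0 : 0 < 1 / (nv G)%:R ^+ c :> R by rewrite divr_gt0// exprn_gt0.
  have zge' : (4 ^ c.+2)%:R <= (nv G)%:R / eps by apply: le_trans zge; rewrite ler_nat.
  have := truncation_error path_es es0 p0 _ probP tailsE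
    (x := Num.sqrt ((nv G)%:R / eps)).
  have x1 : 1 < Num.sqrt ((nv G)%:R / eps).
    rewrite -[X in X < _]sqrtr1 ltr_sqrt ?divr_gt0//.
    apply: lt_le_trans zge'; rewrite ltr1n.
    by rewrite expnS (leq_trans _ (leq_mul (leqnn _) (expn_gt0 4 c.+1))).
  move=> /(_ x1) err; apply: le_lt_trans err _; rewrite lte_fin.
  by apply: horizon_tail_lt; rewrite ?k0.
Qed.

End Correctness.

(** A polynomial in [n] and [1 / eps], at least 1, that dominates the horizon, [n] and [m <= n * n]
    simultaneously. *)
Definition horizon_size (R : realType) (c n : nat) (eps : R) : R :=
  1 + n%:R ^+ c.+2 * eps^-1 + n%:R ^+ 2.

Lemma horizon_poly_bound (R : realType) (c : nat) (f : nat -> nat -> nat -> R) :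
    is_polynomial3 f ->
  exists2 M : R, 0 <= M & exists D, forall n m (eps : R),
    (1 < n)%N -> (m <= n * n)%N -> 0 < eps <= 1 ->
    f (horizon c n eps) n m <= M * horizon_size c n eps ^+ D.
Proof.
move=> [q fq].
(* Restricting to admissible triples makes the size at least 1 everywhere, so that [M] and [D] are
   uniform. *)
pose valid (t : nat * nat * R) :=
  [&& (1 < t.1.1)%N, (t.1.2 <= t.1.1 * t.1.1)%N & 0 < t.2 <= 1].
pose size (t : {t | valid t}) := horizon_size c (val t).1.1 (val t).2.
have monomials_ge0 (t : {t | valid t}) :
    0 <= ((val t).1.1)%:R ^+ c.+2 * (val t).2^-1.
  case: t => [[[n m] eps]] /= /and3P[_ _ /andP[/= e0 _]].
  by rewrite mulr_ge0 ?exprn_ge0// invr_ge0 ltW.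
have size1 t : 1 <= size t.
  have := sqr_ge0 ((val t).1.1%:R : R).
  by rewrite /size /horizon_size; have := monomials_ge0 t; lra.
have bounded (g : {t | valid t} -> R) :
    (forall t, 0 <= g t <= size t) -> poly_bounded size g.
  move=> gle; exists 1 => //; exists 1%N => t.
  by have /andP[g0 g1] := gle t; rewrite mul1r expr1 ger0_norm.
have le_sqr n : n%:R <= n%:R ^+ 2 :> R by rewrite -natrX ler_nat; nia.
have [|||M M0 [D MD]] := @poly_bounded_horner3 R _ size size1
    (fun t => (horizon c (val t).1.1 (val t).2)%:R)
    (fun t => (val t).1.1%:R) (fun t => (val t).1.2%:R) _ _ _ q.
- apply: bounded => t; rewrite ler0n /= /size /horizon_size.
  case: t => [[[n m] eps]] vt /=; have /and3P[/= n1 _ e01] := vt.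
  have := horizon_le c n1 e01; have := sqr_ge0 (n%:R : R); lra.
- apply: bounded => t; rewrite ler0n /= /size /horizon_size.
  by have := monomials_ge0 t; have := le_sqr (val t).1.1; lra.
- apply: bounded => t; rewrite ler0n /= /size /horizon_size.
  have mn : (val t).1.2%:R <= (val t).1.1%:R ^+ 2 :> R.
    by rewrite -natrX ler_nat; case: t => t vt; have /and3P[] := vt.
  by have := monomials_ge0 t; lra.
exists M => //; exists D => n m eps n1 mn e01.
have vt : valid (n, m, eps) by rewrite /valid /= n1 mn e01.
by have := MD (exist (fun t => is_true (valid t)) (n, m, eps) vt); rewrite /size /= -fq; exact: le_trans (ler_norm _).
Qed.

Theorem theorem3 (R : realType) (c : nat) (K : instances R)
    (hK : forall (G : stgraph R) (s y : 'I_(nv G)), K G s y ->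
       [/\ s != y, exists es, is_path s y es &
           forall e : 'I_(ne G), 1 / (nv G)%:R ^+ c <= prob e])
    (f : nat -> nat -> nat -> R)
    (hA : exists A : cmd, computes_tails K A f) :
  exists B : cmd,
    approximates_EX_in_O K B
      (fun n m eps => f (horizon c n eps) n m + n%:R * ln n%:R + m%:R) /\
    (is_polynomial3 f -> fptas K B).
Proof.
have [A [CA CA0 tailsA]] := hA.
have [Z ZE] : {Z | Z = (4 ^ c.+2)%N} by eexists.
have Z0 : (0 < Z)%N by rewrite ZE expn_gt0.
have [L L0 Lsmall] := exists_cutoff R c Z0.
exists (approx_prog c Z L A).
(* Below the threshold only finitely many pairs [(n, m)] occur, so [S] bounds the cost of the first
   [L] tails for an arbitrary [f]. *)
pose S : R := \sum_(n < Z) \sum_(m < Z * Z) `|f L n m|.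
have S0 : 0 <= S by apply: sumr_ge0 => n _; exact: sumr_ge0.
have f_le_S (n m : nat) : (n < Z)%N -> (m < Z * Z)%N -> f L n m <= S.
  move=> nZ mZ; apply: le_trans (ler_norm _) _.
  rewrite /S (bigD1 (Ordinal nZ))//= (bigD1 (Ordinal mZ))//= -addrA lerDl.
  by rewrite addr_ge0// sumr_ge0// => i _; exact: sumr_ge0.
pose C : R := (overhead c)%:R * CA * (1 + S).
have ov0 : 0 < (overhead c)%:R :> R by rewrite ltr0n /overhead addn_gt0 orbT.
have C0 : 0 < C by rewrite !mulr_gt0//; lra.
have graph_bounds (G : stgraph R) (s y : 'I_(nv G)) : K G s y ->
    (1 < nv G)%N /\ (0 < ne G <= nv G * nv G)%N.
  move=> /hK[sy [es path_es] _]; have /andP[k0 kn] := path_size sy path_es.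
  split; first exact: leq_ltn_trans kn.
  rewrite ne_le andbT; case: es k0 {path_es kn} => // e _ _.
  exact: leq_ltn_trans (ltn_ord e).
have main : approximates_EX K (approx_prog c Z L A) (fun n m eps =>
    C * (f (horizon c n eps) n m + n%:R * ln n%:R + m%:R)).
  move=> G s y KG eps eps01; have [sy [es path_es] probP] := hK _ _ _ KG.
  have [n1 /andP[m0 mn]] := graph_bounds _ _ _ KG.
  have /andP[e0 e1] := eps01.
  have hor0 := horizon_gt0 c n1 eps01.
  have [|t [s1 [exA tailsE tle]]] := tailsA G s y KG (cutoff c Z L (nv G) eps).
    by rewrite /cutoff; case: ifP.
  have sz1 : size (tail_output s1) = cutoff c Z L (nv G) eps.
    by have := congr1 size tailsE; rewrite !size_map size_iota.
  have [t' [s2 [ex2 out2 t'le]]] := exec_approx_prog (ltnW n1) eps01 exA sz1.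
  exists t', s2; split=> //.
    rewrite out2; apply: (cutoff_error sy eps01 probP path_es _ Lsmall tailsE).
    by rewrite ZE.
  (* The run of A at the horizon serves only to show that [f] is nonnegative there. *)
  have [t0 [s0 [_ _ t0le]]] := tailsA G s y KG _ hor0.
  have fhor0 : 0 <= f (horizon c (nv G) eps) (nv G) (ne G).
    by rewrite -(pmulr_rge0 _ CA0) (le_trans _ t0le).
  have nln0 : 0 <= (nv G)%:R * ln (nv G)%:R :> R.
    by rewrite mulr_ge0// ln_ge0// ler1n ltnW.
  (* The path has an edge, so the summand [m] dominates the constant 1 and hence, after scaling,
     [S]. *)
  have m1 : 1 <= (ne G)%:R :> R by rewrite ler1n.
  have fle : f (cutoff c Z L (nv G) eps) (nv G) (ne G) <=
      (1 + S) * (f (horizon c (nv G) eps) (nv G) (ne G) +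
                 (nv G)%:R * ln (nv G)%:R + (ne G)%:R).
    rewrite {1}/cutoff; case: ltP => [zlt|_]; last by nra.
    have nZ : (nv G < Z)%N.
      rewrite -(ltr_nat R); apply: le_lt_trans zlt.
      by rewrite ler_pdivlMr// ler_piMr.
    have mZ : (ne G < Z * Z)%N.
      by apply: leq_ltn_trans mn _; rewrite ltn_mul.
    by have := f_le_S _ _ nZ mZ; nra.
  apply: le_trans (_ : (overhead c * t)%:R <= _); first by rewrite ler_nat.
  rewrite natrM /C -!mulrA ler_pM2l// (le_trans tle)// ler_pM2l//.
split; first by exists C.
move=> /(horizon_poly_bound c)[M M0 [D MD]].
(* [horizon_size] as a polynomial, with outer variable [n] and inner variable [1 / eps]. Its two
   extra copies in the final bound cover [n * ln n] and [m], both at most [n ^+ 2]. *)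
pose Y : {poly {poly R}} := 1%:P%:P + 'X^(c.+2) * 'X%:P + 'X^2.
exists (C%:P%:P * (M%:P%:P * Y ^+ D + Y + Y)) => G s y KG eps eps01.
have [t [s' [ex err tle]]] := main G s y KG eps eps01.
exists t, s'; split=> //; apply: le_trans tle _.
have [n1 /andP[_ mn]] := graph_bounds _ _ _ KG; have /andP[e0 _] := eps01.
have YE : Y.[(nv G)%:R%:P].[eps^-1] = horizon_size c (nv G) eps.
  by rewrite /Y !(hornerXn, horner_exp, hornerD, hornerM, hornerC, hornerX).
clearbody Y.
rewrite !(horner_exp, hornerD, hornerM, hornerC) YE ler_pM2l//.
have e0' : 0 <= (nv G)%:R ^+ c.+2 * eps^-1 :> R.
  by rewrite mulr_ge0 ?exprn_ge0// invr_ge0 ltW.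
apply: lerD; first apply: lerD; first exact: MD.
  apply: le_trans (_ : (nv G)%:R ^+ 2 <= _); last by rewrite /horizon_size; lra.
  by rewrite expr2 ler_wpM2l// ltW// ln_sublinear// ltr0n ltnW.
apply: le_trans (_ : (nv G)%:R ^+ 2 <= _); last by rewrite /horizon_size; lra.
by rewrite -natrX ler_nat.
Qed.
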